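(* Let $G=(V,E)$ be an unweighted, undirected graph with $n$ nodes, let $\gamma>0$, $\lambda\in(0,1)$, and let $w_{ij}=1$ if $(i,j)\in E$ and $w_{ij}=\lambda$ otherwise. Let $\mathbf{x}^*=(x^*_{ij})$ be an optimal solution of the sparsest cut LP relaxation $$\min\ \sum_{(i,j)\in E}x_{ij}\quad\text{s.t. }\sum_{i<j}x_{ij}=n,\quad x_{ij}\le x_{ik}+x_{jk}\ \text{for all } i,j,k,\quad x_{ij}\ge0\ \text{for all } i,j,$$ and let $(\hat{\mathbf{x}},\hat{\mathbf{y}})$ be optimal primal and dual variables (satisfying the KKT conditions) for the quadratic program that minimizes $\sum_{(i,j)\in E}x_{ij}+\frac{1}{2\gamma}\sum_{i<j}w_{ij}x_{ij}^2$ over the same constraints. Let $\tilde{\mathbf{x}}=(\tilde x_{ij})$ be an optimal solution of the LP $$\max\ \frac1\gamma\sum_{i<j}(w_{ij}\hat x_{ij})x_{ij}\quad\text{s.t. }\sum_{i<j}x_{ij}=n,\quad \sum_{(i,j)\in E}x_{ij}\le\sum_{(i,j)\in E}\hat x_{ij},\quad 0\le x_{ij}\le\frac{n}{n-1}\ \text{for all } i,j.$$ Then $$n\hat y_2-n\hat y_1-\frac1\gamma\sum_{i<j}w_{ij}\hat x_{ij}\tilde x_{ij}\ \le\ \sum_{(i,j)\in E}x^*_{ij},$$ where $\hat y_1$ and $\hat y_2$ are the entries of $\hat{\mathbf{y}}$ corresponding to the constraints $\sum_{i<j}x_{ij}\le n$ and $-\sum_{i<j}x_{ij}\le -n$ respectively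 (which together form the equality constraint $\sum_{i<j}x_{ij}=n$).
   Context: Variables $x_{ij}$ are real and indexed by unordered pairs of distinct nodes; ''for all $i,j$'' and ''for all $i,j,k$'' range over distinct nodes. The constraints of the quadratic program are written as a system $\mathbf{A}\mathbf{x}\le\mathbf{b}$ consisting of $\sum_{i<j}x_{ij}\le n$, $-\sum_{i<j}x_{ij}\le -n$, $x_{ij}-x_{ik}-x_{jk}\le 0$, and $-x_{ij}\le 0$, with one dual variable per inequality. With $\mathbf{W}=\operatorname{diag}(w_{ij})$ and $\mathbf{c}$ the indicator vector of edges ($c_{ij}=1$ if $(i,j)\in E$, else $0$), the KKT conditions are $\mathbf{A}\hat{\mathbf{x}}\le\mathbf{b}$, $\hat{\mathbf{y}}^T(\mathbf{A}\hat{\mathbf{x}}-\mathbf{b})=0$, $\frac1\gamma\mathbf{W}\hat{\mathbf{x}}=-\mathbf{A}^T\hat{\mathbf{y}}-\mathbf{c}$, $\hat{\mathbf{y}}\ge0$. *)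

(* Defs.v *)
From HB Require Import structures.
From mathcomp Require Import all_boot all_order all_algebra.
From mathcomp Require Import reals.

Set Implicit Arguments.
Unset Strict Implicit.
Unset Printing Implicit Defensive.

Import Order.TTheory GRing.Theory Num.Theory.
Local Open Scope ring_scope.

(* Unordered pairs of distinct nodes; a graph on the node set V is given by its
   edge set E : {set upair V}, and sums over i < j are sums over upair V. *)
Definition upair (V : finType) : finType := {p : {set V} | #|p| == 2}.

Lemma upair_subproof (V : finType) (i j : V) : i != j -> #|[set i; j]| == 2.
Proof. by move=> ij; rewrite cards2 ij. Qed.

Definition mkpair (V : finType) (i j : V) (ij : i != j) : upair V :=
  exist _ [set i; j] (upair_subproof ij).

(* The triangle inequality x_ij <= x_ik + x_jk is symmetric in i and j, so it is
   indexed by an unordered pair {i, j} together with a third node k. *)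
Definition triangle (V : finType) : finType :=
  {t : upair V * V | t.2 \notin val t.1}.

(* Row indices of the system A x <= b. *)
Inductive constr (V : finType) : Type :=
  | SumLe
  | SumGe
  | Tri of triangle V
  | Nonneg of upair V.

Arguments SumLe {V}.
Arguments SumGe {V}.

Definition constr_code (V : finType) (r : constr V) :
    bool + (triangle V + upair V) :=
  match r with
  | SumLe => inl true
  | SumGe => inl false
  | Tri t => inr (inl t)
  | Nonneg p => inr (inr p)
  end.

Definition constr_decode (V : finType) (s : bool + (triangle V + upair V)) :
    constr V :=
  match s with
  | inl true => SumLe
  | inl false => SumGe
  | inr (inl t) => Tri t
  | inr (inr p) => Nonneg p
  end.

Lemma constr_codeK (V : finType) :
  cancel (@constr_code V) (@constr_decode V).
Proof. by case. Qed.

HB.instance Definition _ (V : finType) :=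
  Finite.copy (constr V) (can_type (@constr_codeK V)).

Definition vec (R : realType) (T : finType) (x : {ffun T -> R}) :
    'cV[R]_#|T| :=
  \col_i x (enum_val i).

Definition le_vec (R : realType) (m : nat) (u v : 'cV[R]_m) : Prop :=
  forall i, u i 0 <= v i 0.

(* The row Tri ({i, j}, k) is x_ij - x_ik - x_jk; the sum over the two elements of
   the pair produces the last two terms. *)
Definition coefA (R : realType) (V : finType) (r : constr V) (q : upair V) : R :=
  match r with
  | SumLe => 1
  | SumGe => -1
  | Tri t => let: (p, k) := val t in
      (q == p)%:R - \sum_(i in val p) (val q == [set i; k])%:R
  | Nonneg p => - (q == p)%:R
  end.

Definition matA (R : realType) (V : finType) :
    'M[R]_(#|{: constr V}|, #|{: upair V}|) :=
  \matrix_(r, q) coefA R (enum_val r) (enum_val q).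

Definition rhsb (R : realType) (V : finType) : {ffun constr V -> R} :=
  [ffun r => match r with
             | SumLe => #|V|%:R
             | SumGe => - #|V|%:R
             | _ => 0
             end].

Definition weight (R : realType) (V : finType) (E : {set upair V}) (lambda : R) :
    {ffun upair V -> R} :=
  [ffun p => if p \in E then 1 else lambda].

Definition edge_ind (R : realType) (V : finType) (E : {set upair V}) :
    {ffun upair V -> R} :=
  [ffun p => (p \in E)%:R].

Definition KKT (R : realType) (V : finType) (E : {set upair V})
    (gamma lambda : R) (x : {ffun upair V -> R}) (y : {ffun constr V -> R}) :
    Prop :=
  [/\ le_vec (matA R V *m vec x) (vec (rhsb R V)),
      (vec y)^T *m (matA R V *m vec x - vec (rhsb R V)) = 0,
      gamma^-1 *: (diag_mx (vec (weight E lambda))^T *m vec x)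
        = - ((matA R V)^T *m vec y) - vec (edge_ind R E)
    & le_vec 0 (vec y)].

Definition minimizes (R : realType) (T : Type) (F : T -> Prop) (f : T -> R)
    (x : T) : Prop :=
  F x /\ forall z, F z -> f x <= f z.

Definition maximizes (R : realType) (T : Type) (F : T -> Prop) (f : T -> R)
    (x : T) : Prop :=
  F x /\ forall z, F z -> f z <= f x.

Definition metric_feasible (R : realType) (V : finType)
    (x : {ffun upair V -> R}) : Prop :=
  [/\ \sum_p x p = #|V|%:R,
      forall (i j k : V) (ij : i != j) (ik : i != k) (jk : j != k),
        x (mkpair ij) <= x (mkpair ik) + x (mkpair jk)
    & forall p, 0 <= x p].

Definition lp_obj (R : realType) (V : finType) (E : {set upair V})
    (x : {ffun upair V -> R}) : R :=
  \sum_(p in E) x p.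

Definition qp_obj (R : realType) (V : finType) (E : {set upair V})
    (gamma lambda : R) (x : {ffun upair V -> R}) : R :=
  \sum_(p in E) x p
  + (2 * gamma)^-1 * \sum_p weight E lambda p * x p ^+ 2.

Definition bound_feasible (R : realType) (V : finType) (E : {set upair V})
    (xhat x : {ffun upair V -> R}) : Prop :=
  [/\ \sum_p x p = #|V|%:R,
      \sum_(p in E) x p <= \sum_(p in E) xhat p
    & forall p, 0 <= x p <= #|V|%:R / (#|V|%:R - 1)].

Definition bound_obj (R : realType) (V : finType) (E : {set upair V})
    (gamma lambda : R) (xhat x : {ffun upair V -> R}) : R :=
  gamma^-1 * \sum_p (weight E lambda p * xhat p) * x p.

(* Main.v *)
Require Import Defs.
From mathcomp Require Import all_boot all_order all_algebra.
From mathcomp Require Import reals.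

Set Implicit Arguments.
Unset Strict Implicit.
Unset Printing Implicit Defensive.

Import Order.TTheory GRing.Theory Num.Theory.
Local Open Scope ring_scope.

(** The claim is weak duality followed by a comparison of two feasible sets.
    Let [n] be the number of nodes.  Pair the stationarity condition
    [gamma^-1 W xhat = - A^T y - c] with a metric [x]: since [A x <= b] and
    [y >= 0], this gives
      [n * y SumGe - n * y SumLe
         = - y^T b <= - y^T A x = c^T x + gamma^-1 * xhat^T W x],
    which is [KKT_dual_bound].  Apply it to [x = xstar].  The first term on the
    right is then the optimal value of the linear program, and the second is at
    most its value at [xtilde], because [xstar] competes in the maximization
    that [xtilde] solves: it costs no more than [xhat] on the edges, being
    optimal among metrics, and none of its entries exceeds [n / (n - 1)].

    That entrywise bound ([metric_entry_le]) comes from the triangle inequality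
    by counting.  For a pair [{i, j}], each of the [n - 2] other nodes [k] gives
    [x_ij <= x_ik + x_jk]; the pairs on the right are all distinct and differ
    from [{i, j}], so [(n - 1) * x_ij] is at most [n], the sum of all entries. *)

Lemma sum_vec (R : realType) (T : finType) (F : T -> R) :
  \sum_(i < #|T|) F (enum_val i) = \sum_t F t.
Proof. by rewrite -big_enum_val. Qed.

Lemma sum_pick (R : realType) (T : finType) (x : T -> R) (p : T) :
  \sum_q (q == p)%:R * x q = x p.
Proof.
rewrite (bigD1 p) //= eqxx mul1r big1 ?addr0 // => q.
by move=> /negbTE ->; rewrite mul0r.
Qed.

Lemma sum_eq_mkpair (R : realType) (V : finType) (x : {ffun upair V -> R})
    (i k : V) (ik : i != k) :
  \sum_q (val q == [set i; k])%:R * x q = x (mkpair ik).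
Proof. exact: (sum_pick x (mkpair ik)). Qed.

(** The coefficient on the right is the one that the rows [Tri] of the
    constraint matrix use.  In this form the inequality serves both for reading
    off those rows and for summing over [k]. *)
Lemma metric_triangle (R : realType) (V : finType) (x : {ffun upair V -> R})
    (p : upair V) (k : V) :
  metric_feasible x -> k \notin val p ->
  x p <= \sum_q (\sum_(i in val p) (val q == [set i; k])%:R) * x q.
Proof.
case=> _ tri _.
have /cards2P [i [j [ij pE]]] := valP p.
have -> : p = mkpair ij by exact: val_inj.
rewrite /= !inE negb_or ![k == _]eq_sym => /andP [ik jk].
under eq_bigr => q _ do rewrite mulr_suml.
by rewrite exchange_big big_setU1 ?inE //= big_set1 !sum_eq_mkpair tri.
Qed.

(** Splitting the two elements of [q] between the inside and the outside of [p],
    [q] is counted on the left as a pair [{i, k}] only if it has exactly one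
    element on each side, and then only once; [q = p] is the case of no element
    outside. *)
Lemma crossing_pair_count (V : finType) (p q : upair V) :
  ((q == p) + \sum_(k | k \notin val p) \sum_(i in val p)
     (val q == [set i; k]) <= 1)%N.
Proof.
have crossE :
    (\sum_(k | k \notin val p) \sum_(i in val p) (val q == [set i; k])
       <= #|val q :\: val p| * #|val q :&: val p|)%N.
  rewrite -!sum1_card big_distrl /=.
  under [X in (_ <= X)%N]eq_bigl => k do rewrite !inE.
  rewrite [X in (_ <= X)%N]big_mkcondr /=; apply: leq_sum => k _.
  case: ifPn => kq; last first.
    rewrite big1 // => i _; case: eqP => // qE.
    by rewrite qE !inE eqxx orbT in kq.
  rewrite mul1n; under [X in (_ <= X)%N]eq_bigl => i do rewrite inE andbC.
  rewrite [X in (_ <= X)%N]big_mkcondr /=; apply: leq_sum => i _.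
  by case: eqP => // ->; rewrite !inE eqxx.
apply: leq_trans (leq_add (leqnn _) crossE) _.
have := cardsID (val p) (val q); rewrite (eqP (valP q)).
case: (eqVneq q p) => [-> | qp]; first by rewrite setDv cards0.
by case: #|_ :&: _| => [|[|[|?]]]; case: #|_ :\: _| => [|[|[|?]]].
Qed.

Lemma card_notin_upair (V : finType) (p : upair V) :
  #|[pred k | k \notin val p]|.+2 = #|V|.
Proof. by rewrite -(cardC (val p)) (eqP (valP p)). Qed.

Lemma metric_entry_le (R : realType) (V : finType) (x : {ffun upair V -> R})
    (p : upair V) :
  metric_feasible x -> x p <= #|V|%:R / (#|V|%:R - 1).
Proof.
move=> xF; have [xsum _ x_ge0] := xF.
have nE := card_notin_upair p.
have n1_gt0 : 0 < #|V|%:R - 1 :> R by rewrite subr_gt0 ltr1n -nE.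
rewrite ler_pdivlMr // -[leRHS]xsum.
have -> : x p * (#|V|%:R - 1) = x p + \sum_(k | k \notin val p) x p.
  rewrite sumr_const -nE -natr1 addrK -addn1 natrD mulrDr mulr1.
  by rewrite mulr_natr addrC.
apply: (@le_trans _ _ (\sum_q (q == p)%:R * x q +
  \sum_(k | k \notin val p)
    \sum_q (\sum_(i in val p) (val q == [set i; k])%:R) * x q)).
  rewrite sum_pick lerD2l; apply: ler_sum => k kp.
  exact: metric_triangle.
(* After exchanging the sums, the coefficient of each entry is the number
   bounded in [crossing_pair_count]. *)
rewrite exchange_big -big_split /=; apply: ler_sum => q _.
rewrite -mulr_suml -mulrDl ler_piMl //.
under eq_bigr => k _ do rewrite -natr_sum.
by rewrite -natr_sum -natrD lern1 crossing_pair_count.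
Qed.

Lemma metric_row_le (R : realType) (V : finType) (x : {ffun upair V -> R})
    (r : constr V) :
  metric_feasible x -> \sum_q coefA R r q * x q <= rhsb R V r.
Proof.
move=> xF; have [xsum _ x_ge0] := xF; rewrite ffunE.
case: r => [||[[p k] /= kp]|p] /=.
- by under eq_bigr => q _ do rewrite mul1r; rewrite xsum.
- by under eq_bigr => q _ do rewrite mulN1r; rewrite sumrN xsum.
- under eq_bigr => q _ do rewrite mulrBl.
  by rewrite big_split /= sumrN sum_pick subr_le0 metric_triangle.
- under eq_bigr => q _ do rewrite mulNr.
  by rewrite sumrN sum_pick oppr_le0.
Qed.

Lemma sum_rhsb (R : realType) (V : finType) (y : {ffun constr V -> R}) :
  \sum_r y r * rhsb R V r = #|V|%:R * y SumLe - #|V|%:R * y SumGe.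
Proof.
rewrite (bigD1 SumLe) // (bigD1 SumGe) //= !ffunE big1 ?addr0.
  by rewrite mulrN ![y _ * _]mulrC.
by case=> [||t|p] // _; rewrite ffunE mulr0.
Qed.

Lemma KKT_stationarity (R : realType) (V : finType) (E : {set upair V})
    (gamma lambda : R) (x : {ffun upair V -> R}) (y : {ffun constr V -> R})
    (q : upair V) :
  KKT E gamma lambda x y ->
  gamma^-1 * (weight E lambda q * x q)
    = - (\sum_r coefA R r q * y r) - (q \in E)%:R.
Proof.
case=> _ _ /matrixP /(_ (enum_rank q) 0) + _.
rewrite mul_diag_mx !mxE !enum_rankK ffunE => ->.
rewrite ffunE -(sum_vec (fun r => coefA R r q * y r)); congr (- _ - _).
by apply: eq_bigr => r _; rewrite !mxE enum_rankK.
Qed.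

Lemma KKT_dual_ge0 (R : realType) (V : finType) (E : {set upair V})
    (gamma lambda : R) (x : {ffun upair V -> R}) (y : {ffun constr V -> R})
    (r : constr V) :
  KKT E gamma lambda x y -> 0 <= y r.
Proof. by case=> _ _ _ /(_ (enum_rank r)); rewrite !mxE enum_rankK. Qed.

(** Weak duality for the linear program whose cost vector is the gradient at [x]
    of the quadratic objective: the right-hand side is that cost of [z], and
    stationarity says that [y] is a dual solution. *)
Lemma KKT_dual_bound (R : realType) (V : finType) (E : {set upair V})
    (gamma lambda : R) (x z : {ffun upair V -> R}) (y : {ffun constr V -> R}) :
  KKT E gamma lambda x y -> metric_feasible z ->
  #|V|%:R * y SumGe - #|V|%:R * y SumLe
    <= lp_obj E z + bound_obj E gamma lambda x z.
Proof.
move=> xyK zF; rewrite /lp_obj /bound_obj mulr_sumr.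
have -> : \sum_(p in E) z p = \sum_p (p \in E)%:R * z p.
  rewrite big_mkcond; apply: eq_bigr => p _.
  by case: (p \in E); rewrite ?mul1r ?mul0r.
rewrite -big_split /=.
under eq_bigr => p _.
  rewrite mulrA (KKT_stationarity p xyK) -mulrDl addrC subrK mulNr mulr_suml.
  over.
rewrite sumrN exchange_big /= -opprB -sum_rhsb lerN2; apply: ler_sum => r _.
under eq_bigr => p _ do rewrite [coefA _ _ _ * _]mulrC -mulrA.
by rewrite -mulr_sumr ler_wpM2l ?(KKT_dual_ge0 _ xyK) ?metric_row_le.
Qed.

Theorem corollary6 (R : realType) (V : finType) (E : {set upair V})
    (gamma lambda : R) (xstar xhat xtilde : {ffun upair V -> R})
    (yhat : {ffun constr V -> R})
    (gamma_gt0 : 0 < gamma) (lambda_01 : 0 < lambda < 1)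
    (xstar_opt : minimizes (@metric_feasible R V) (lp_obj E) xstar)
    (xhat_opt : minimizes (@metric_feasible R V) (qp_obj E gamma lambda) xhat)
    (xhat_yhat_KKT : KKT E gamma lambda xhat yhat)
    (xtilde_opt : maximizes (bound_feasible E xhat)
                    (bound_obj E gamma lambda xhat) xtilde) :
  #|V|%:R * yhat SumGe - #|V|%:R * yhat SumLe
    - gamma^-1 * \sum_p weight E lambda p * xhat p * xtilde p
  <= \sum_(p in E) xstar p.
Proof.
have [starF star_min] := xstar_opt; have [hatF _] := xhat_opt.
have [_ tilde_max] := xtilde_opt; have [star_sum _ star_ge0] := starF.
have star_bound : bound_feasible E xhat xstar.
  split=> [//||p]; first exact: star_min hatF.
  by rewrite star_ge0 metric_entry_le.
rewrite lerBlDr; apply: le_trans (KKT_dual_bound xhat_yhat_KKT starF) _.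
by rewrite lerD2l; apply: tilde_max.
Qed.
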